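(* Let $\textnormal{R}\in\{\textnormal{ML},\textnormal{wML},\textnormal{C},\textnormal{S},\textnormal{CH},\textnormal{wCH}\}$, let $\varphi$ be a computable precise temporal forecasting system, and let $\omega\in\Omega$ be a path that is $\textnormal{R}$-random for $\varphi$. Then $I_\textnormal{R}(\omega)=I_\varphi(\omega)$, where $I_\varphi(\omega)=\big[\liminf_{n\to\infty}\underline{\varphi}(\omega_{1:n}),\ \limsup_{n\to\infty}\overline{\varphi}(\omega_{1:n})\big]$.
   Context: $\mathcal{X}=\{0,1\}$; $\Omega=\mathcal{X}^{\mathbb{N}}$ (paths $\omega=(\omega_1,\omega_2,\dots)$); $\mathbb{S}=\bigcup_{n\geq0}\mathcal{X}^n$ (situations), $\square$ the empty string, $|s|$ length, $sx$ concatenation, $\omega_{1:n}=(\omega_1,\dots,\omega_n)$, $\omega_{1:0}=\square$. $\mathcal{I}$: nonempty closed intervals $I\subseteq[0,1]$. A forecasting system is a map $\varphi:\mathbb{S}\to\mathcal{I}$; $\underline{\varphi}=\min\varphi$, $\overline{\varphi}=\max\varphi$; precise if $\underline\varphi=\overline\varphi$; temporal if $\varphi(s)=\varphi(t)$ whenever $|s|=|t|$. An interval forecast $I$ is identified with the constant forecasting system $s\mapsto I$. A real map $r$ on a countable effectively encoded set $\mathcal D$ is computable if there is a recursive $q:\mathcal{D}\times\mathbb{N}_0\to\mathbb{Q}$ with $|r(d)-q(d,n)|<2^{-n}$; lower semicomputable if there is a recursive $q$ with $q(d,n+1)\ge q(d,n)$ and $r(d)=\lim_n q(d,n)$. $\varphi$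 is computable if $\underline\varphi,\overline\varphi$ are. $\overline{E}_I(f)=\max_{p\in I}[pf(1)+(1-p)f(0)]$ for $f:\mathcal X\to\mathbb R$. A real process $F:\mathbb S\to\mathbb R$ is a supermartingale for $\varphi$ if $\overline{E}_{\varphi(s)}(F(s\,\cdot)-F(s))\le0$ for all $s$; a test supermartingale if also $F\ge0$, $F(\square)=1$. A multiplier process $D$ maps situations to gambles and generates $D^{\circledcirc}(x_1,\dots,x_n)=\prod_{k=0}^{n-1}D(x_{1:k})(x_{k+1})$; $D$ is lower semicomputable if $(s,x)\mapsto D(s)(x)$ is. Randomness for a path $\omega$ and forecasting system $\varphi$: ML-random if no lower semicomputable test supermartingale $T$ for $\varphi$ has $\limsup_nT(\omega_{1:n})=\infty$; wML-random if no test supermartingale for $\varphi$ of the form $D^{\circledcirc}$, $D$ a lower semicomputable multiplier process, has this; C-random if no computable test supermartingale for $\varphi$ has this; S-random if there is no computable test supermartingale $T$ for $\varphi$ together with a computable non-decreasing unbounded $\tau:\mathbb N_0\to\mathbb R_{\ge0}$ such that $\limsup_n[T(\omega_{1:n})-\tau(n)]\ge0$. CH-random (resp. wCH-random) if for every recursive (resp. recursive and temporal, i.e. depending only on $|s|$) selection process $S:\mathbb S\to\{0,1\}$ with $\sum_{k=0}^{n-1}S(\omega_{1:k})\to\infty$: $\liminf_n \frac{\sum_{k<n}S(\omega_{1:k})[\omega_{k+1}-\underline\varphi(\omega_{1:k})]}{\sum_{k<n}S(\omega_{1:k})}\ge0$ and $\limsup_n \frac{\sum_{k<n}S(\omega_{1:k})[\omega_{k+1}-\overline\varphi(\omega_{1:k})]}{\sum_{k<n}S(\omega_{1:k})}\le0$.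 $\mathcal I_\textnormal{R}(\omega)=\{I\in\mathcal I:\omega\text{ is R-random for }I\}$, $I_\textnormal{R}(\omega)=\bigcap_{I\in\mathcal I_\textnormal{R}(\omega)}I$. *)

(* Defs.v *)
From Stdlib Require Import Reals Lra List.
From Coquelicot Require Import Coquelicot.
Import ListNotations.
Open Scope R_scope.

(* A model of computability: mu-recursive functions on nat (unary,     *)
(* with Cantor pairing to handle several arguments).                   *)

Definition cpair (a b : nat) : nat := (((a + b) * (a + b + 1)) / 2 + b)%nat.

Inductive rf : Type :=
| rZero | rSucc | rId | rFst | rSnd
| rPair (f g : rf)
| rComp (f g : rf)
| rPrec (f g : rf)
| rMin (f : rf).

Inductive rf_eval : rf -> nat -> nat -> Prop :=
| ev_zero x : rf_eval rZero x 0
| ev_succ x : rf_eval rSucc x (S x)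
| ev_id x : rf_eval rId x x
| ev_fst a b : rf_eval rFst (cpair a b) a
| ev_snd a b : rf_eval rSnd (cpair a b) b
| ev_pair f g x a b : rf_eval f x a -> rf_eval g x b -> rf_eval (rPair f g) x (cpair a b)
| ev_comp f g x y z : rf_eval g x y -> rf_eval f y z -> rf_eval (rComp f g) x z
| ev_prec0 f g x y : rf_eval f x y -> rf_eval (rPrec f g) (cpair x 0) y
| ev_precS f g x n y z :
    rf_eval (rPrec f g) (cpair x n) y -> rf_eval g (cpair x (cpair n y)) z ->
    rf_eval (rPrec f g) (cpair x (S n)) z
| ev_min f x n :
    rf_eval f (cpair x n) 0 ->
    (forall m, (m < n)%nat -> exists v, rf_eval f (cpair x m) (S v)) ->
    rf_eval (rMin f) x n.

Definition recursive_fun (g : nat -> nat) : Prop :=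
  exists f : rf, forall x, rf_eval f x (g x).

Definition recursive_Q (q : nat -> R) : Prop :=
  exists a b c : nat -> nat,
    recursive_fun a /\ recursive_fun b /\ recursive_fun c /\
    forall x, q x = (INR (a x) - INR (b x)) / (INR (c x) + 1).

Definition situation := list bool.   (* x_1 ... x_n, head = x_1 *)
Definition path := nat -> bool.      (* omega_{k+1} = omega k *)

Definition prefix (w : path) (n : nat) : situation := map w (seq 0 n).

Definition b2n (b : bool) : nat := if b then 1%nat else 0%nat.
Definition b2R (b : bool) : R := if b then 1 else 0.

(* a bijective, effective encoding of situations into nat *)
Fixpoint enc_sit (s : situation) : nat :=
  match s with
  | [] => 0%nat
  | x :: t => (2 * enc_sit t + 1 + b2n x)%nat
  end.

Definition enc_sitx (p : situation * bool) : nat := cpair (enc_sit (fst p)) (b2n (snd p)).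

Definition computable_on {D : Type} (enc : D -> nat) (r : D -> R) : Prop :=
  exists q : nat -> R, recursive_Q q /\
    forall d n, Rabs (r d - q (cpair (enc d) n)) < (/ 2) ^ n.

Definition lower_semicomputable_on {D : Type} (enc : D -> nat) (r : D -> R) : Prop :=
  exists q : nat -> R, recursive_Q q /\
    (forall d n, q (cpair (enc d) n) <= q (cpair (enc d) (S n))) /\
    (forall d, Un_cv (fun n => q (cpair (enc d) n)) (r d)).

(* phi(s) = [lo s, hi s] *)
Record fsys := FSys { lo : situation -> R ; hi : situation -> R }.

Definition valid_interval (a b : R) : Prop := 0 <= a /\ a <= b /\ b <= 1.

Definition valid_fsys (phi : fsys) : Prop :=
  forall s, valid_interval (lo phi s) (hi phi s).

Definition precise (phi : fsys) : Prop := forall s, lo phi s = hi phi s.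

Definition temporal (phi : fsys) : Prop :=
  forall s t, length s = length t -> lo phi s = lo phi t /\ hi phi s = hi phi t.

Definition computable_fsys (phi : fsys) : Prop :=
  computable_on enc_sit (lo phi) /\ computable_on enc_sit (hi phi).

Definition const_fsys (a b : R) : fsys := FSys (fun _ => a) (fun _ => b).

(* \overline{E}_{[a,b]}(f) <= 0, with the max over p in [a,b] unfolded *)
Definition upper_exp_nonpos (a b : R) (f : bool -> R) : Prop :=
  forall p, a <= p <= b -> p * f true + (1 - p) * f false <= 0.

Definition supermartingale (phi : fsys) (F : situation -> R) : Prop :=
  forall s, upper_exp_nonpos (lo phi s) (hi phi s)
              (fun x => F (s ++ [x]) - F s).

Definition test_supermartingale (phi : fsys) (F : situation -> R) : Prop :=
  supermartingale phi F /\ (forall s, 0 <= F s) /\ F [] = 1.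

Fixpoint mult_from (D : situation -> bool -> R) (pre rest : situation) : R :=
  match rest with
  | [] => 1
  | x :: r => D pre x * mult_from D (pre ++ [x]) r
  end.

Definition mult_proc (D : situation -> bool -> R) (s : situation) : R :=
  mult_from D [] s.

Definition limsup_infty (u : nat -> R) : Prop :=
  forall M N, exists n, (N <= n)%nat /\ M < u n.

Definition limsup_ge0 (u : nat -> R) : Prop :=
  forall eps N, 0 < eps -> exists n, (N <= n)%nat /\ - eps < u n.

Definition liminf_ge0 (u : nat -> R) : Prop :=
  forall eps, 0 < eps -> exists N, forall n, (N <= n)%nat -> - eps <= u n.

Definition limsup_le0 (u : nat -> R) : Prop :=
  forall eps, 0 < eps -> exists N, forall n, (N <= n)%nat -> u n <= eps.

Definition ML_random (phi : fsys) (w : path) : Prop :=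
  ~ exists T, lower_semicomputable_on enc_sit T /\ test_supermartingale phi T /\
      limsup_infty (fun n => T (prefix w n)).

Definition wML_random (phi : fsys) (w : path) : Prop :=
  ~ exists D : situation -> bool -> R,
      lower_semicomputable_on enc_sitx (fun p => D (fst p) (snd p)) /\
      test_supermartingale phi (mult_proc D) /\
      limsup_infty (fun n => mult_proc D (prefix w n)).

Definition C_random (phi : fsys) (w : path) : Prop :=
  ~ exists T, computable_on enc_sit T /\ test_supermartingale phi T /\
      limsup_infty (fun n => T (prefix w n)).

Definition S_random (phi : fsys) (w : path) : Prop :=
  ~ exists (T : situation -> R) (tau : nat -> R),
      computable_on enc_sit T /\ test_supermartingale phi T /\
      computable_on (fun n : nat => n) tau /\
      (forall n, 0 <= tau n) /\
      (forall n m, (n <= m)%nat -> tau n <= tau m) /\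
      (forall M, exists n, M < tau n) /\
      limsup_ge0 (fun n => T (prefix w n) - tau n).

Fixpoint rsum (f : nat -> R) (n : nat) : R :=
  match n with O => 0 | S m => rsum f m + f m end.

Definition recursive_selection (Sel : situation -> bool) : Prop :=
  exists g : nat -> nat, recursive_fun g /\ forall s, g (enc_sit s) = b2n (Sel s).

Definition temporal_selection (Sel : situation -> bool) : Prop :=
  forall s t, length s = length t -> Sel s = Sel t.

Definition CH_condition (phi : fsys) (w : path) (Sel : situation -> bool) : Prop :=
  let cnt := fun n => rsum (fun k => b2R (Sel (prefix w k))) n in
  (forall M, exists N, forall n, (N <= n)%nat -> M <= cnt n) ->
  liminf_ge0 (fun n =>
     rsum (fun k => b2R (Sel (prefix w k)) * (b2R (w k) - lo phi (prefix w k))) n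
     / cnt n) /\
  limsup_le0 (fun n =>
     rsum (fun k => b2R (Sel (prefix w k)) * (b2R (w k) - hi phi (prefix w k))) n
     / cnt n).

Definition CH_random (phi : fsys) (w : path) : Prop :=
  forall Sel, recursive_selection Sel -> CH_condition phi w Sel.

Definition wCH_random (phi : fsys) (w : path) : Prop :=
  forall Sel, recursive_selection Sel -> temporal_selection Sel -> CH_condition phi w Sel.

Inductive rnotion := RML | RwML | RC | RS | RCH | RwCH.

Definition random (Rn : rnotion) : fsys -> path -> Prop :=
  match Rn with
  | RML => ML_random | RwML => wML_random | RC => C_random
  | RS => S_random | RCH => CH_random | RwCH => wCH_random
  end.

Definition I_R (Rn : rnotion) (w : path) (x : R) : Prop :=
  forall a b, valid_interval a b -> random Rn (const_fsys a b) w -> a <= x <= b.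

Definition I_phi (phi : fsys) (w : path) (x : R) : Prop :=
  Rbar_le (LimInf_seq (fun n => lo phi (prefix w n))) (Finite x) /\
  Rbar_le (Finite x) (LimSup_seq (fun n => hi phi (prefix w n))).

(* Main.v *)
(* Randomness for phi passes to any forecasting system that contains phi from some
   time N on: a test that succeeds on w against the larger system can be restarted
   with capital 1 after the prefix of w of length N, and is then a test against phi.
   Constant intervals slightly larger than [liminf, limsup] are of this kind.

   Conversely, suppose w is random both for phi and for [a, b], and that phi exceeds
   some q > r > b infinitely often.  As phi is computable and temporal, a recursive set
   of times captures this.  Betting there with stake 1/M on outcomes exceeding r is a
   rational-valued test for [a, b]; betting on outcomes below q is one for phi.  Since
   1 + y >= exp (y - 2 y^2), a mean gain of delta on the first c selected times yields a
   capital of at least c / M^2, so both mean gains must eventually be small, although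
   they add up to q - r.  The lower end point is symmetric. *)
Require Import Defs.
From Stdlib Require Import Reals Lra Lia List Arith Cantor Bool Classical.
From Coquelicot Require Import Coquelicot.
Import ListNotations.
Open Scope R_scope.

(** * Recursive functions *)

Definition cfst (z : nat) : nat := fst (Cantor.of_nat z).
Definition csnd (z : nat) : nat := snd (Cantor.of_nat z).

(** Identifying [cpair] with the Cantor bijection gives it total inverses, so that every number can
    be read as a pair. *)
Lemma cpair_to_nat a b : cpair a b = Cantor.to_nat (a, b).
Proof.
  unfold cpair. pose proof (Cantor.to_nat_spec a b) as H.
  assert (E : ((a + b) * (a + b + 1) = (Cantor.to_nat (a, b) - b) * 2)%nat) by nia.
  rewrite E, Nat.div_mul by lia. nia.
Qed.

Lemma cfst_cpair a b : cfst (cpair a b) = a.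
Proof. unfold cfst. now rewrite cpair_to_nat, Cantor.cancel_of_to. Qed.

Lemma csnd_cpair a b : csnd (cpair a b) = b.
Proof. unfold csnd. now rewrite cpair_to_nat, Cantor.cancel_of_to. Qed.

Lemma cpair_cfst_csnd z : cpair (cfst z) (csnd z) = z.
Proof.
  unfold cfst, csnd. rewrite cpair_to_nat, <- surjective_pairing.
  apply Cantor.cancel_to_of.
Qed.

Lemma rec_ext f g : (forall x, f x = g x) -> recursive_fun f -> recursive_fun g.
Proof. intros E [p Hp]. exists p. intros x. rewrite <- E. apply Hp. Qed.

Lemma rec_id : recursive_fun (fun x => x).
Proof. exists rId. intros x. constructor. Qed.

Lemma rec_comp f g :
  recursive_fun f -> recursive_fun g -> recursive_fun (fun x => f (g x)).
Proof. intros [p Hp] [q Hq]. exists (rComp p q). intros x. econstructor; eauto. Qed.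

Lemma rec_S f : recursive_fun f -> recursive_fun (fun x => S (f x)).
Proof. apply (rec_comp S). exists rSucc. intros x. constructor. Qed.

Lemma rec_const c : recursive_fun (fun _ => c).
Proof.
  induction c as [|c IH].
  - exists rZero. intros x. constructor.
  - now apply rec_S.
Qed.

Lemma rec_cfst f : recursive_fun f -> recursive_fun (fun x => cfst (f x)).
Proof.
  apply (rec_comp cfst). exists rFst. intros x.
  rewrite <- (cpair_cfst_csnd x) at 1. constructor.
Qed.

Lemma rec_csnd f : recursive_fun f -> recursive_fun (fun x => csnd (f x)).
Proof.
  apply (rec_comp csnd). exists rSnd. intros x.
  rewrite <- (cpair_cfst_csnd x) at 1. constructor.
Qed.

Lemma rec_pair f g :
  recursive_fun f -> recursive_fun g -> recursive_fun (fun x => cpair (f x) (g x)).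
Proof. intros [p Hp] [q Hq]. exists (rPair p q). intros x. constructor; auto. Qed.

(** The source of the arithmetic below: [F] sees the parameter, the step number and the value so
    far, packed in the order that [ev_precS] prescribes. *)
Lemma rec_nat_rect (a n : nat -> nat) (F : nat -> nat -> nat -> nat) :
  recursive_fun a -> recursive_fun n ->
  recursive_fun (fun z => F (cfst z) (cfst (csnd z)) (csnd (csnd z))) ->
  recursive_fun (fun x => nat_rect (fun _ => nat) (a x) (F x) (n x)).
Proof.
  intros [pa Ha] Hn [pF HF].
  assert (H : recursive_fun
    (fun z => nat_rect (fun _ => nat) (a (cfst z)) (F (cfst z)) (csnd z))).
  { exists (rPrec pa pF). intros z.
    rewrite <- (cpair_cfst_csnd z) at 1.
    induction (csnd z) as [|m IH]; simpl.
    - constructor. apply Ha.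
    - econstructor; [exact IH|].
      pose proof (HF (cpair (cfst z)
        (cpair m (nat_rect (fun _ => nat) (a (cfst z)) (F (cfst z)) m)))) as E.
      rewrite !csnd_cpair, !cfst_cpair in E. exact E. }
  refine (rec_ext _ _ _ (rec_comp _ _ H (rec_pair _ _ rec_id Hn))).
  intros x. cbv beta. now rewrite cfst_cpair, csnd_cpair.
Qed.

Create HintDb rec.
#[local] Hint Resolve rec_id rec_const rec_S rec_cfst rec_csnd rec_pair : rec.

Lemma rec_add f g :
  recursive_fun f -> recursive_fun g -> recursive_fun (fun x => f x + g x)%nat.
Proof.
  intros Hf Hg.
  apply (rec_ext (fun x => nat_rect (fun _ => nat) (f x) (fun _ y => S y) (g x))).
  - intros x. induction (g x); cbn [nat_rect]; lia.
  - apply (rec_nat_rect f g (fun _ _ y => S y)); auto with rec.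
Qed.
#[local] Hint Resolve rec_add : rec.

Lemma rec_mul f g :
  recursive_fun f -> recursive_fun g -> recursive_fun (fun x => f x * g x)%nat.
Proof.
  intros Hf Hg.
  apply (rec_ext (fun x => nat_rect (fun _ => nat) 0%nat (fun _ y => y + f x)%nat (g x))).
  - intros x. induction (g x); cbn [nat_rect]; nia.
  - apply (rec_nat_rect (fun _ => 0%nat) g (fun x _ y => y + f x)%nat); auto with rec.
    apply rec_add; auto with rec. apply (rec_comp f); auto with rec.
Qed.
#[local] Hint Resolve rec_mul : rec.

Lemma rec_pred f : recursive_fun f -> recursive_fun (fun x => pred (f x)).
Proof.
  intros Hf.
  apply (rec_ext (fun x => nat_rect (fun _ => nat) 0%nat (fun n _ => n) (f x))).
  - intros x. now destruct (f x).
  - apply (rec_nat_rect (fun _ => 0%nat) f (fun _ n _ => n)); auto with rec.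
Qed.
#[local] Hint Resolve rec_pred : rec.

Lemma rec_sub f g :
  recursive_fun f -> recursive_fun g -> recursive_fun (fun x => f x - g x)%nat.
Proof.
  intros Hf Hg.
  apply (rec_ext (fun x => nat_rect (fun _ => nat) (f x) (fun _ y => pred y) (g x))).
  - intros x. induction (g x); cbn [nat_rect]; lia.
  - apply (rec_nat_rect f g (fun _ _ y => pred y)); auto with rec.
Qed.
#[local] Hint Resolve rec_sub : rec.

(** Decidable conditions are carried as boolean functions whose [b2n] is recursive; the case
    distinction is then arithmetic. *)
Lemma rec_if (b : nat -> bool) f g :
  recursive_fun (fun x => b2n (b x)) -> recursive_fun f -> recursive_fun g ->
  recursive_fun (fun x => if b x then f x else g x).
Proof.
  intros Hb Hf Hg.
  apply (rec_ext (fun x => b2n (b x) * f x + (1 - b2n (b x)) * g x)%nat).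
  - intros x. destruct (b x); simpl; lia.
  - auto 7 with rec.
Qed.
#[local] Hint Resolve rec_if : rec.

Lemma rec_leb f g :
  recursive_fun f -> recursive_fun g -> recursive_fun (fun x => b2n (f x <=? g x)%nat).
Proof.
  intros Hf Hg. apply (rec_ext (fun x => 1 - (f x - g x))%nat).
  - intros x. destruct (Nat.leb_spec (f x) (g x)); unfold b2n; lia.
  - auto with rec.
Qed.
#[local] Hint Resolve rec_leb : rec.

Lemma rec_negb b :
  recursive_fun (fun x => b2n (b x)) -> recursive_fun (fun x => b2n (negb (b x))).
Proof.
  intros Hb. apply (rec_ext (fun x => 1 - b2n (b x))%nat).
  - intros x. now destruct (b x).
  - auto with rec.
Qed.

Lemma rec_andb b c :
  recursive_fun (fun x => b2n (b x)) -> recursive_fun (fun x => b2n (c x)) ->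
  recursive_fun (fun x => b2n (b x && c x)).
Proof.
  intros Hb Hc. apply (rec_ext (fun x => b2n (b x) * b2n (c x))%nat).
  - intros x. now destruct (b x), (c x).
  - auto with rec.
Qed.

Lemma rec_odd f : recursive_fun f -> recursive_fun (fun x => b2n (Nat.odd (f x))).
Proof.
  intros Hf.
  apply (rec_ext (fun x => nat_rect (fun _ => nat) 0%nat (fun _ y => 1 - y)%nat (f x))).
  - intros x. induction (f x) as [|n IH]; [reflexivity|].
    cbn [nat_rect]. rewrite IH, Nat.odd_succ, <- Nat.negb_odd.
    now destruct (Nat.odd n).
  - apply (rec_nat_rect (fun _ => 0%nat) f (fun _ _ y => 1 - y)%nat); auto with rec.
Qed.
#[local] Hint Resolve rec_negb rec_andb rec_odd : rec.

(** Half of n, rounded down, counts the odd numbers below n, and counting is a primitive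
    recursion. *)
Lemma rec_div2 f : recursive_fun f -> recursive_fun (fun x => Nat.div2 (f x)).
Proof.
  intros Hf.
  apply (rec_ext (fun x => nat_rect (fun _ => nat) 0%nat
                             (fun n y => y + b2n (Nat.odd n))%nat (f x))).
  - intros x. induction (f x) as [|n IH]; [reflexivity|].
    cbn [nat_rect]. rewrite IH.
    pose proof (Nat.div2_odd n) as E. pose proof (Nat.div2_odd (S n)) as E'.
    rewrite Nat.odd_succ, <- Nat.negb_odd in E'.
    destruct (Nat.odd n); simpl Nat.b2n in *; unfold b2n; simpl negb in *; simpl Nat.b2n in *; lia.
  - apply (rec_nat_rect (fun _ => 0%nat) f (fun _ n y => y + b2n (Nat.odd n))%nat);
      auto with rec.
Qed.
#[local] Hint Resolve rec_div2 : rec.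

(** * Reading situations from their codes *)

Lemma div2_enc t x : Nat.div2 (pred (enc_sit (x :: t))) = enc_sit t.
Proof.
  simpl. replace (pred _) with (b2n x + 2 * enc_sit t)%nat by lia.
  rewrite Nat.div2_div, (Nat.mul_comm 2), Nat.div_add by lia.
  destruct x; reflexivity.
Qed.

Lemma odd_enc t x : Nat.odd (pred (enc_sit (x :: t))) = x.
Proof.
  simpl. replace (pred _) with (b2n x + 2 * enc_sit t)%nat by lia.
  rewrite Nat.odd_add_mul_2. now destruct x.
Qed.

Lemma length_le_enc s : (length s <= enc_sit s)%nat.
Proof. induction s; simpl; lia. Qed.

(* [k] is the position of the head of [s] in the whole situation. *)
Fixpoint foldi (F : nat -> nat -> nat -> nat) (k : nat) (s : situation) (acc : nat) : nat :=
  match s with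
  | [] => acc
  | x :: t => foldi F (S k) t (F k (b2n x) acc)
  end.

Lemma foldi_snoc F s x : forall k acc,
  foldi F k (s ++ [x]) acc = F (k + length s)%nat (b2n x) (foldi F k s acc).
Proof.
  induction s as [|y s IH]; intros k acc; simpl.
  - now rewrite Nat.add_0_r.
  - now rewrite IH, Nat.add_succ_r.
Qed.

(** A loop whose state pairs the code of the unread part with the accumulator; each step strips one
    letter by halving and parity. A code bounds the length of its situation, so it serves as the
    number of steps; once the code is 0, further steps change nothing. *)
Lemma rec_foldi F acc :
  recursive_fun (fun z => F (cfst z) (cfst (csnd z)) (csnd (csnd z))) ->
  exists G, recursive_fun G /\ forall s, G (enc_sit s) = foldi F 0 s acc.
Proof.
  intros HF.
  set (step := fun n y : nat =>
    if (1 <=? cfst y)%nat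
    then cpair (Nat.div2 (pred (cfst y))) (F n (b2n (Nat.odd (pred (cfst y)))) (csnd y))
    else y).
  set (run := fun e n => nat_rect (fun _ => nat) (cpair e acc) step n).
  exists (fun e => csnd (run e e)). split.
  - apply rec_csnd.
    apply (rec_nat_rect (fun e => cpair e acc) (fun e => e) (fun _ => step));
      auto with rec.
    unfold step. apply rec_if; auto with rec. apply rec_pair; [auto 7 with rec|].
    refine (rec_ext _ _ _ (rec_comp _ (fun z => cpair (cfst (csnd z))
      (cpair (b2n (Nat.odd (pred (cfst (csnd (csnd z)))))) (csnd (csnd (csnd z))))) HF _)).
    + intros z. cbv beta. now rewrite !csnd_cpair, !cfst_cpair.
    + auto 10 with rec.
  - intros s. pose proof (length_le_enc s) as Ls.
    (* Invariant: after n steps the first n letters are folded and the remaining ones are still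
       coded. *)
    assert (R : forall n, run (enc_sit s) n
       = cpair (enc_sit (skipn n s)) (foldi F 0 (firstn n s) acc)).
    { induction n as [|n IH]; [reflexivity|].
      change (run (enc_sit s) (S n)) with (step n (run (enc_sit s) n)).
      rewrite IH. unfold step. rewrite cfst_cpair, csnd_cpair.
      destruct (Nat.lt_ge_cases n (length s)) as [L|L].
      - destruct (nth_split s false L) as (l1 & l2 & E & El).
        set (x := nth n s false) in *.
        replace (firstn (S n) s) with (l1 ++ [x]).
        2:{ rewrite E, firstn_app, El, firstn_all2 by lia.
            now replace (S n - n)%nat with 1%nat by lia. }
        replace (skipn (S n) s) with l2.
        2:{ rewrite E, skipn_app, El, skipn_all2 by lia.
            now replace (S n - n)%nat with 1%nat by lia. }
        replace (firstn n s) with l1.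
        2:{ rewrite E, firstn_app, El, firstn_all2 by lia.
            now rewrite Nat.sub_diag, app_nil_r. }
        replace (skipn n s) with (x :: l2).
        2:{ rewrite E, skipn_app, El, skipn_all2 by lia.
            now rewrite Nat.sub_diag. }
        rewrite div2_enc, odd_enc, foldi_snoc, El. simpl (0 + n)%nat.
        destruct (Nat.leb_spec 1 (enc_sit (x :: l2))) as [|C]; [reflexivity|].
        simpl in C. lia.
      - rewrite !skipn_all2, !firstn_all2 by lia. reflexivity. }
    rewrite R, csnd_cpair.
    now rewrite firstn_all2 by exact Ls.
Qed.

Lemma rec_length :
  exists G, recursive_fun G /\ forall s, G (enc_sit s) = length s.
Proof.
  destruct (rec_foldi (fun _ _ acc => S acc) 0) as (G & HG & E); [auto with rec|].
  exists G. split; [exact HG|]. intros s. rewrite E.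
  induction s as [|x s IH] using rev_ind; [reflexivity|].
  rewrite foldi_snoc, IH, length_app. simpl. lia.
Qed.

(** The shorter situation comes first. The test is boolean because it has to enter recursive
    functions. *)
Fixpoint extends (u s : situation) : bool :=
  match u, s with
  | [], _ => true
  | y :: u', x :: s' => eqb x y && extends u' s'
  | _ :: _, [] => false
  end.

Lemma rec_extends u :
  exists b : nat -> bool, recursive_fun (fun e => b2n (b e)) /\
    forall s, b (enc_sit s) = extends u s.
Proof.
  induction u as [|y u (b & Hb & E)].
  - exists (fun _ => true). split; [apply rec_const|reflexivity].
  - exists (fun e => (1 <=? e)%nat && ((if y then Nat.odd (pred e) else negb (Nat.odd (pred e))) &&
                     b (Nat.div2 (pred e)))).
    split.
    + apply rec_andb; auto with rec. apply rec_andb.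
      * destruct y; auto with rec.
      * apply (rec_comp (fun e => b2n (b e))); auto with rec.
    + intros [|x s]; [reflexivity|].
      rewrite div2_enc, odd_enc, E.
      destruct (Nat.leb_spec 1 (enc_sit (x :: s))) as [|C]; [|simpl in C; lia].
      simpl. now destruct x, y.
Qed.

(** Isolates the boundary case of a restarted test: the subtree above [u] can be entered only at [u]
    itself. *)
Lemma extends_snoc u s x :
  extends u (s ++ [x]) = true <-> extends u s = true \/ u = s ++ [x].
Proof.
  revert u. induction s as [|z s IH]; intros [|y u]; simpl.
  - intuition discriminate.
  - destruct u as [|y' u], x, y; simpl; split; intuition (try discriminate; congruence).
  - intuition discriminate.
  - rewrite !andb_true_iff, IH, eqb_true_iff.
    split; [intros (-> & [H|H]); subst; auto|].
    intros [H|H]; [tauto|]. injection H as -> ->. auto.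
Qed.

Lemma extends_length u s : extends u s = true -> (length u <= length s)%nat.
Proof.
  revert s. induction u as [|y u IH]; intros [|x s]; simpl; try lia; try discriminate.
  rewrite andb_true_iff. intros [_ H]. apply IH in H. lia.
Qed.

(** * Betting on selected outcomes *)

Lemma recursive_Q_frac a d :
  recursive_fun a -> recursive_fun d ->
  recursive_Q (fun x => INR (a x) / (INR (pred (d x)) + 1)).
Proof.
  intros Ha Hd. exists a, (fun _ => 0%nat), (fun x => pred (d x)).
  repeat split; auto with rec. intros x. simpl INR. now rewrite Rminus_0_r.
Qed.

Lemma INR_pred_add1 d : (0 < d)%nat -> INR (pred d) + 1 = INR d.
Proof. intros H. rewrite <- S_INR. f_equal. lia. Qed.

(** An exactly known rational is its own constant approximation, monotone and with error 0. Hence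
    one betting strategy serves the computable and the lower semicomputable notions alike. *)
Lemma exact_computable {D : Type} (enc : D -> nat) (r : D -> R) (q : nat -> R) :
  recursive_Q q -> (forall d, q (enc d) = r d) ->
  computable_on enc r /\ lower_semicomputable_on enc r.
Proof.
  intros (a & b & c & Ha & Hb & Hc & E) Hq.
  assert (HQ : recursive_Q (fun z => q (cfst z))).
  { exists (fun z => a (cfst z)), (fun z => b (cfst z)), (fun z => c (cfst z)).
    split; [apply (rec_comp a); auto with rec|].
    split; [apply (rec_comp b); auto with rec|].
    split; [apply (rec_comp c); auto with rec|].
    intros x. apply E. }
  split; exists (fun z => q (cfst z)); (split; [exact HQ|]).
  - intros d n. rewrite cfst_cpair, Hq, Rminus_diag, Rabs_R0.
    apply pow_lt. lra.
  - split.
    + intros d n. rewrite !cfst_cpair. lra.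
    + intros d eps Heps. exists 0%nat. intros n _.
      rewrite cfst_cpair, Hq. unfold Rdist. now rewrite Rminus_diag, Rabs_R0.
Qed.

Lemma mult_from_snoc D s : forall pre x,
  mult_from D pre (s ++ [x]) = mult_from D pre s * D (pre ++ s) x.
Proof.
  induction s as [|y s IH]; intros pre x; simpl.
  - rewrite app_nil_r. ring.
  - rewrite IH, <- app_assoc. simpl. ring.
Qed.

Lemma mult_proc_snoc D s x : mult_proc D (s ++ [x]) = mult_proc D s * D s x.
Proof. apply mult_from_snoc. Qed.

Lemma prefix_S w n : prefix w (S n) = prefix w n ++ [w n].
Proof. unfold prefix. now rewrite seq_S, map_app. Qed.

Lemma prefix_length w n : length (prefix w n) = n.
Proof. unfold prefix. now rewrite length_map, length_seq. Qed.

Lemma extends_prefix w N n :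
  (N <= n)%nat -> extends (prefix w N) (prefix w n) = true.
Proof.
  induction 1 as [|n _ IH].
  - induction (prefix w N) as [|x s IH]; simpl; [reflexivity|].
    now rewrite eqb_reflx.
  - rewrite prefix_S. apply extends_snoc. now left.
Qed.

(** * Finite sums and selection counts *)

Lemma rsum_ext f g n : (forall k, f k = g k) -> rsum f n = rsum g n.
Proof. intros E. induction n; simpl; [reflexivity|]. now rewrite IHn, E. Qed.

Lemma rsum_le f g n : (forall k, f k <= g k) -> rsum f n <= rsum g n.
Proof. intros E. induction n; simpl; [lra|]. specialize (E n). lra. Qed.

Lemma rsum_plus f g n : rsum (fun k => f k + g k) n = rsum f n + rsum g n.
Proof. induction n; simpl; [lra|]. rewrite IHn. ring. Qed.

Lemma rsum_scal c f n : rsum (fun k => c * f k) n = c * rsum f n.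
Proof. induction n; simpl; [lra|]. rewrite IHn. ring. Qed.

Lemma rsum_b2R_mono (g : nat -> bool) n m : (n <= m)%nat ->
  rsum (fun k => b2R (g k)) n <= rsum (fun k => b2R (g k)) m.
Proof.
  induction 1 as [|m _ IH]; simpl; [lra|]. destruct (g m); simpl; lra.
Qed.

Lemma rsum_b2R_ge0 (g : nat -> bool) n : 0 <= rsum (fun k => b2R (g k)) n.
Proof. apply (rsum_b2R_mono g 0). lia. Qed.

Lemma rsum_b2R_diverges (g : nat -> bool) :
  (forall N, exists n, (N <= n)%nat /\ g n = true) ->
  forall M, exists N, forall n, (N <= n)%nat -> M <= rsum (fun k => b2R (g k)) n.
Proof.
  intros Hg M. destruct (INR_unbounded M) as [m Hm].
  enough (exists N, INR m <= rsum (fun k => b2R (g k)) N) as [N HN].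
  { exists N. intros n Hn. pose proof (rsum_b2R_mono g N n Hn). lra. }
  clear Hm. induction m as [|m [N IH]].
  - exists 0%nat. simpl. lra.
  - destruct (Hg N) as (n & Hn & E). exists (S n). rewrite S_INR. simpl rsum.
    rewrite E. pose proof (rsum_b2R_mono g N n Hn). simpl. lra.
Qed.

(** [up] is the side of the bet: on ones at price [r], or against them. *)
Definition gain (up : bool) (r : R) (x : bool) : R :=
  if up then b2R x - r else r - b2R x.

(** At selected times the fraction 1/M of the current capital is staked. [g] looks only at the
    length, so the selection is temporal, as weak Church randomness requires. *)
Definition bet (g : nat -> bool) (up : bool) (r : R) (M : nat)
    (s : situation) (x : bool) : R :=
  if g (length s) then 1 + gain up r x / INR M else 1.

Lemma bet_rational up u v M :
  (0 < v)%nat -> (u <= v)%nat -> (0 < M)%nat ->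
  exists num : bool -> nat, forall x,
    1 + gain up (INR u / INR v) x / INR M = INR (num x) / INR (M * v).
Proof.
  intros Hv Hu HM.
  (* Over the common denominator M v. The subtrahend is at most v, hence at most M v, so the
     truncated subtraction is exact. *)
  exists (fun x => M * v + (if eqb x up then v else 0) - (if up then u else v - u))%nat.
  intros x.
  assert (0 < INR v) by (apply lt_0_INR; lia).
  assert (0 < INR M) by (apply lt_0_INR; lia).
  assert (v <= M * v)%nat by nia.
  rewrite minus_INR by (destruct up; lia). rewrite plus_INR, mult_INR.
  destruct up, x; simpl; rewrite ?minus_INR by lia; simpl; field; lra.
Qed.

(** Each factor is a fraction of naturals, 1/1 at unselected times, and the capital comes from
    folding numerators and denominators separately. The multipliers are for weak Martin-Löf
    randomness, the capital is for the other martingale notions. *)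
Lemma bet_recursive g up u v M :
  recursive_fun (fun n => b2n (g n)) ->
  (0 < v)%nat -> (u <= v)%nat -> (0 < M)%nat ->
  let D := bet g up (INR u / INR v) M in
  (exists q, recursive_Q q /\ forall p, q (enc_sitx p) = D (fst p) (snd p)) /\
  (exists q, recursive_Q q /\ forall s, q (enc_sit s) = mult_proc D s).
Proof.
  intros Hg Hv Hu HM D.
  destruct (bet_rational up u v M Hv Hu HM) as [num Hnum].
  set (d := (M * v)%nat) in *.
  assert (Hd : (0 < d)%nat) by (unfold d; nia).
  assert (Hd' : 0 < INR d) by now apply lt_0_INR.
  set (nm := fun b => if (1 <=? b)%nat then num true else num false).
  assert (Enm : forall x, nm (b2n x) = num x) by now intros [].
  assert (Rnm : forall f, recursive_fun f -> recursive_fun (fun z => nm (f z))).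
  { intros f Hf. unfold nm. auto with rec. }
  assert (Rg : forall f, recursive_fun f -> recursive_fun (fun z => b2n (g (f z)))).
  { intros f Hf. exact (rec_comp _ f Hg Hf). }
  assert (ED : forall s x, D s x = INR (if g (length s) then num x else 1)
                                  / INR (if g (length s) then d else 1)).
  { intros s x. unfold D, bet. rewrite Hnum. destruct (g (length s)); simpl; [reflexivity|field]. }
  split.
  - destruct rec_length as (len & Hlen & Elen).
    set (a := fun z => if g (len (cfst z)) then nm (csnd z) else 1%nat).
    set (c := fun z => if g (len (cfst z)) then d else 1%nat).
    exists (fun z => INR (a z) / (INR (pred (c z)) + 1)).
    assert (Hl : recursive_fun (fun z => b2n (g (len (cfst z))))).
    { apply Rg, (rec_comp len); auto with rec. }
    split.
    + apply recursive_Q_frac; apply rec_if; auto with rec.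
    + intros [s x]. unfold enc_sitx. simpl fst. simpl snd.
      rewrite INR_pred_add1 by (unfold c; destruct (g _); lia).
      unfold a, c. now rewrite cfst_cpair, csnd_cpair, Elen, Enm, ED.
  - destruct (rec_foldi (fun k b acc => acc * (if g k then nm b else 1))%nat 1)
      as (A & HA & EA).
    { auto 8 with rec. }
    destruct (rec_foldi (fun k b acc => acc * (if g k then d else 1))%nat 1)
      as (C & HC & EC).
    { auto 8 with rec. }
    exists (fun z => INR (A z) / (INR (pred (C z)) + 1)).
    split; [now apply recursive_Q_frac|]. intros s.
    assert (H : (0 < C (enc_sit s))%nat /\
                INR (A (enc_sit s)) / INR (C (enc_sit s)) = mult_proc D s).
    { rewrite EA, EC.
      induction s as [|x s [IH1 IH2]] using rev_ind.
      - simpl. split; [lia|]. unfold mult_proc. simpl. lra.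
      - rewrite !foldi_snoc, mult_proc_snoc, <- IH2, ED, Enm, !mult_INR. simpl (0 + _)%nat.
        split; [destruct (g _); nia|].
        apply lt_0_INR in IH1. destruct (g (length s)); simpl; field; lra. }
    destruct H as [H1 H2]. now rewrite INR_pred_add1.
Qed.

(** * The betting capital as a test and its growth *)

Lemma gain_bounds up r x : 0 <= r <= 1 -> -1 <= gain up r x <= 1.
Proof. intros H. destruct up, x; simpl; lra. Qed.

Lemma bet_factor_bounds up r M x :
  0 <= r <= 1 -> (2 <= M)%nat -> - (1 / 2) <= gain up r x / INR M <= 1 / 2.
Proof.
  intros Hr HM. apply le_INR in HM. simpl in HM.
  pose proof (gain_bounds up r x Hr).
  split; [apply Rle_div_r|apply Rle_div_l]; lra.
Qed.

(** The factors are at least 1/2, so the capital stays nonnegative. Under probability p its expected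
    increment at a selected time is T/M times p - r or r - p, and the hypothesis puts every p of the
    forecast on the losing side of [r]. *)
Lemma bet_test_supermartingale psi g (up : bool) r M :
  0 <= r <= 1 -> (2 <= M)%nat ->
  (forall s, g (length s) = true -> if up then hi psi s <= r else r <= lo psi s) ->
  test_supermartingale psi (mult_proc (bet g up r M)).
Proof.
  intros Hr HM Hsel.
  assert (Pos : forall s, 0 <= mult_proc (bet g up r M) s).
  { induction s as [|x s IH] using rev_ind.
    - unfold mult_proc. simpl. lra.
    - rewrite mult_proc_snoc. apply Rmult_le_pos; [exact IH|].
      unfold bet. pose proof (bet_factor_bounds up r M x Hr HM).
      destruct (g _); lra. }
  split; [|split; [exact Pos|reflexivity]].
  intros s p Hp. rewrite !mult_proc_snoc. specialize (Pos s). unfold bet.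
  assert (HM' : 0 < / INR M) by (apply Rinv_0_lt_compat, lt_0_INR; lia).
  specialize (Hsel s). destruct (g (length s)); [|lra].
  specialize (Hsel eq_refl).
  set (T := mult_proc _ s) in *.
  replace (_ + _) with (T * / INR M * (if up then p - r else r - p))
    by (unfold gain, Rdiv; destruct up; simpl b2R; ring).
  assert (0 <= T * / INR M) by (apply Rmult_le_pos; lra).
  destruct up; nra.
Qed.

(** With z = y - 2 y^2, the bound exp (-z) >= 1 - z reduces the claim to (1 + y) (1 - z) = 1 + y^2
    (1 + 2 y) >= 1. *)
Lemma exp_le_1_plus y : - (1 / 2) <= y -> exp (y - 2 * y ^ 2) <= 1 + y.
Proof.
  intros Hy. set (z := y - 2 * y ^ 2).
  pose proof (exp_ineq1_le (- z)) as H1.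
  pose proof (exp_pos z). pose proof (exp_pos (- z)) as Hp.
  assert (E : exp z * exp (- z) = 1)
    by (rewrite <- exp_plus, Rplus_opp_r; apply exp_0).
  apply (Rmult_le_reg_r (exp (- z))); [exact Hp|]. rewrite E.
  apply Rle_trans with ((1 + y) * (1 + - z)).
  - unfold z. replace (_ * _) with (1 + y ^ 2 * (1 + 2 * y)) by ring.
    pose proof (pow2_ge_0 y). nra.
  - apply Rmult_le_compat_l; lra.
Qed.

(** The exponential bound is applied to each selected factor; its quadratic loss is at most 2 / M^2
    because a gain has absolute value at most 1. *)
Lemma bet_growth w g up r M n :
  0 <= r <= 1 -> (2 <= M)%nat ->
  exp (/ INR M * rsum (fun k => b2R (g k) * gain up r (w k)) n
       - 2 / INR M ^ 2 * rsum (fun k => b2R (g k)) n)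
  <= mult_proc (bet g up r M) (prefix w n).
Proof.
  intros Hr HM.
  assert (HM' : 0 < INR M) by (apply lt_0_INR; lia).
  induction n as [|n IH].
  - simpl. rewrite !Rmult_0_r, Rminus_0_r, exp_0. unfold mult_proc. simpl. lra.
  - rewrite prefix_S, mult_proc_snoc. simpl rsum.
    set (A := rsum _ n) in *. set (B := rsum (fun k => b2R (g k)) n) in *.
    replace (_ - _) with ((/ INR M * A - 2 / INR M ^ 2 * B) +
       b2R (g n) * (gain up r (w n) / INR M - 2 / INR M ^ 2)) by (field; lra).
    rewrite exp_plus. apply Rmult_le_compat; try (left; apply exp_pos); [exact IH|].
    unfold bet. rewrite prefix_length. destruct (g n); simpl b2R.
    + pose proof (bet_factor_bounds up r M (w n) Hr HM) as Hb.
      pose proof (gain_bounds up r (w n) Hr) as Hg.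
      eapply Rle_trans; [|apply exp_le_1_plus, Hb].
      set (y := gain up r (w n)) in *.
      assert (L : (y / INR M) ^ 2 <= / INR M ^ 2).
      { replace ((y / INR M) ^ 2) with (y ^ 2 * / INR M ^ 2) by (field; lra).
        assert (0 < / INR M ^ 2) by (apply Rinv_0_lt_compat, pow_lt, HM').
        assert (y ^ 2 <= 1) by nra. nra. }
      assert (exp_mono : forall a b, a <= b -> exp a <= exp b).
      { intros a b [Hab| ->]; [left; now apply exp_increasing|lra]. }
      apply exp_mono. unfold Rdiv at 2. lra.
    + rewrite Rmult_0_l, exp_0. lra.
Qed.

(** For M >= 4 / delta, a total gain A > delta B on B selected times makes A / M at least 4 B / M^2,
    which outweighs the quadratic loss 2 B / M^2. The bound is kept explicit because it becomes the
    growth function for Schnorr randomness. *)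
Lemma bet_defeats w g up r M delta :
  0 <= r <= 1 -> (2 <= M)%nat -> 4 / delta <= INR M -> 0 < delta ->
  (forall N, exists n, (N <= n)%nat /\
    delta * rsum (fun k => b2R (g k)) n
      < rsum (fun k => b2R (g k) * gain up r (w k)) n) ->
  forall N, exists n, (N <= n)%nat /\
    rsum (fun k => b2R (g k)) n / INR M ^ 2
      < mult_proc (bet g up r M) (prefix w n).
Proof.
  intros Hr HM HMd Hd Hinf N.
  destruct (Hinf N) as (n & Hn & H). exists n. split; [exact Hn|].
  pose proof (bet_growth w g up r M n Hr HM) as Hg.
  pose proof (rsum_b2R_ge0 g n) as Hc.
  set (A := rsum (fun k => b2R (g k) * _) n) in *. set (B := rsum (fun k => b2R (g k)) n) in *.
  assert (HM' : 0 < / INR M) by (apply Rinv_0_lt_compat, lt_0_INR; lia).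
  assert (HM0 : 0 < INR M) by (apply lt_0_INR; lia).
  assert (L : B / INR M ^ 2 <= / INR M * A - 2 / INR M ^ 2 * B).
  { replace (B / INR M ^ 2) with (/ INR M * (B * / INR M)) by (field; lra).
    replace (2 / INR M ^ 2 * B) with (/ INR M * (2 * (B * / INR M))) by (field; lra).
    rewrite <- Rmult_minus_distr_l. apply Rmult_le_compat_l; [lra|].
    assert (4 * / INR M <= delta).
    { apply Rle_div_l in HMd; [|lra]. apply Rle_div_l; [exact HM0|lra]. }
    assert (0 <= B * / INR M) by (apply Rmult_le_pos; [exact Hc|lra]).
    nra. }
  pose proof (exp_ineq1_le (/ INR M * A - 2 / INR M ^ 2 * B)). lra.
Qed.

(** * Frequencies along random paths *)

Lemma limsup_le0_opp (s x y c : nat -> R) :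
  limsup_le0 (fun n => rsum (fun k => s k * (x k - y k)) n / c n) <->
  liminf_ge0 (fun n => rsum (fun k => s k * (y k - x k)) n / c n).
Proof.
  assert (E : forall n, rsum (fun k => s k * (y k - x k)) n / c n
                        = - (rsum (fun k => s k * (x k - y k)) n / c n)).
  { intros n. rewrite (rsum_ext _ (fun k => -1 * (s k * (x k - y k)))) by (intros; ring).
    rewrite rsum_scal. unfold Rdiv. ring. }
  split; intros H eps Heps; destruct (H eps Heps) as [N HN]; exists N; intros n Hn;
    specialize (HN n Hn); rewrite E in *; lra.
Qed.

(** At selected times [r] lies beyond the end point of the forecast, so the gain against [r] is at
    most the gain against that end point, which the Church condition controls. *)
Lemma CH_frequency psi w (g : nat -> bool) (up : bool) r delta :
  (forall s, g (length s) = true -> if up then hi psi s <= r else r <= lo psi s) ->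
  (forall N, exists n, (N <= n)%nat /\ g n = true) ->
  CH_condition psi w (fun s => g (length s)) -> 0 < delta ->
  exists N, forall n, (N <= n)%nat ->
    rsum (fun k => b2R (g k) * gain up r (w k)) n <= delta * rsum (fun k => b2R (g k)) n.
Proof.
  intros Hsel Hinf HCH Hd.
  pose proof (rsum_b2R_diverges g Hinf) as Hdiv.
  assert (Ec : forall n, rsum (fun k => b2R (g (length (prefix w k)))) n
                         = rsum (fun k => b2R (g k)) n).
  { intros n. apply rsum_ext. intros k. now rewrite prefix_length. }
  destruct HCH as [Hlo Hhi].
  { intros M. destruct (Hdiv M) as [N HN]. exists N. intros n Hn. rewrite Ec. auto. }
  (* From [N1] on the count is at least 1, so the quotient can be cleared. *)
  destruct (Hdiv 1) as [N1 HN1].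
  destruct up.
  - destruct (Hhi delta Hd) as [N2 HN2]. exists (Nat.max N1 N2). intros n Hn.
    assert (Hc : 1 <= rsum (fun k => b2R (g k)) n) by (apply HN1; lia).
    specialize (HN2 n ltac:(lia)). rewrite Ec in HN2.
    apply Rle_div_l in HN2; [|lra].
    eapply Rle_trans; [|exact HN2]. apply rsum_le. intros k.
    rewrite prefix_length. specialize (Hsel (prefix w k)).
    rewrite prefix_length in Hsel. unfold gain.
    destruct (g k); simpl b2R at 1 3; [specialize (Hsel eq_refl)|]; lra.
  - apply limsup_le0_opp in Hlo. destruct (Hlo delta Hd) as [N2 HN2].
    exists (Nat.max N1 N2). intros n Hn.
    assert (Hc : 1 <= rsum (fun k => b2R (g k)) n) by (apply HN1; lia).
    specialize (HN2 n ltac:(lia)). cbv beta in HN2. rewrite Ec in HN2.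
    apply Rle_div_l in HN2; [|lra].
    eapply Rle_trans; [|exact HN2]. apply rsum_le. intros k.
    rewrite prefix_length. specialize (Hsel (prefix w k)).
    rewrite prefix_length in Hsel. unfold gain.
    destruct (g k); simpl b2R at 1 3; [specialize (Hsel eq_refl)|]; lra.
Qed.

(** A consequence shared by all six notions. If the bound failed infinitely often, the bet at the
    rational price u/v would be a successful test; the Church notions give the bound directly. *)
Lemma random_frequency Rn psi w (g : nat -> bool) (up : bool) u v delta :
  recursive_fun (fun n => b2n (g n)) -> (0 < v)%nat -> (u <= v)%nat ->
  (forall s, g (length s) = true ->
     if up then hi psi s <= INR u / INR v else INR u / INR v <= lo psi s) ->
  (forall N, exists n, (N <= n)%nat /\ g n = true) ->
  random Rn psi w -> 0 < delta ->
  exists N, forall n, (N <= n)%nat ->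
    rsum (fun k => b2R (g k) * gain up (INR u / INR v) (w k)) n
      <= delta * rsum (fun k => b2R (g k)) n.
Proof.
  intros Hg Hv Hu Hsel Hinf HR Hd.
  assert (Hr : 0 <= INR u / INR v <= 1).
  { apply le_INR in Hu. apply lt_0_INR in Hv. pose proof (pos_INR u).
    split; [apply Rle_div_r|apply Rle_div_l]; lra. }
  assert (HSel : recursive_selection (fun s => g (length s))).
  { destruct rec_length as (len & Hlen & Elen).
    exists (fun z => b2n (g (len z))). split.
    - exact (rec_comp _ len Hg Hlen).
    - intros s. now rewrite Elen. }
  destruct (classic (exists N, forall n, (N <= n)%nat ->
    rsum (fun k => b2R (g k) * gain up (INR u / INR v) (w k)) n
      <= delta * rsum (fun k => b2R (g k)) n)) as [|HN]; [assumption|exfalso].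
  (* Large enough for both M >= 2 and M >= 4 / delta. *)
  destruct (INR_unbounded (4 / delta + 2)) as [M HM].
  assert (HM2 : (2 <= M)%nat).
  { apply INR_le. simpl. assert (0 < 4 / delta) by (apply Rdiv_lt_0_compat; lra). lra. }
  assert (Hfreq : forall N, exists n, (N <= n)%nat /\
    delta * rsum (fun k => b2R (g k)) n
      < rsum (fun k => b2R (g k) * gain up (INR u / INR v) (w k)) n).
  { intros N. apply NNPP. intros C. apply HN. exists N. intros n Hn.
    apply Rnot_lt_le. intros L. apply C. now exists n. }
  pose proof (bet_defeats w g up _ M delta Hr HM2 ltac:(lra) Hd Hfreq) as Hdef.
  pose proof (bet_test_supermartingale psi g up _ M Hr HM2 Hsel) as Htest.
  destruct (bet_recursive g up u v M Hg Hv Hu ltac:(lia))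
    as [(qD & HqD & EqD) (qT & HqT & EqT)].
  set (D := bet g up (INR u / INR v) M) in *.
  pose proof (exact_computable enc_sitx (fun p => D (fst p) (snd p)) qD HqD EqD) as [_ LD].
  pose proof (exact_computable enc_sit (mult_proc D) qT HqT EqT) as [CT LT].
  assert (HM0 : 0 < INR M ^ 2) by (apply pow_lt, lt_0_INR; lia).
  assert (Hlim : limsup_infty (fun n => mult_proc D (prefix w n))).
  { intros B N.
    destruct (rsum_b2R_diverges g Hinf (B * INR M ^ 2)) as [N1 HN1].
    destruct (Hdef (Nat.max N N1)) as (n & Hn & L). exists n. split; [lia|].
    eapply Rle_lt_trans; [|exact L]. apply Rle_div_r; [exact HM0|]. apply HN1. lia. }
  destruct Rn; simpl in HR.
  - apply HR. exists (mult_proc D). auto.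
  - apply HR. exists D. auto.
  - apply HR. exists (mult_proc D). auto.
  - apply HR.
    (* The growth function is the bound of [bet_defeats]: a recursive count divided by M^2, exceeded
       by the capital at arbitrarily late times. *)
    exists (mult_proc D), (fun n => rsum (fun k => b2R (g k)) n / INR M ^ 2).
    split; [exact CT|]. split; [exact Htest|]. split; [|split; [|split; [|split]]].
    + set (c := fun n => nat_rect (fun _ => nat) 0%nat (fun k y => y + b2n (g k))%nat n).
      assert (Hc : recursive_fun c).
      { apply (rec_nat_rect (fun _ => 0%nat) (fun n => n)
                 (fun _ k y => y + b2n (g k))%nat); auto with rec.
        apply rec_add; auto with rec. apply (rec_comp (fun n => b2n (g n))); auto with rec. }
      apply (exact_computable (fun n => n) _
               (fun n => INR (c n) / (INR (pred (M * M)) + 1))).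
      * apply recursive_Q_frac; auto with rec.
      * intros n. rewrite INR_pred_add1 by nia. rewrite mult_INR.
        replace (INR (c n)) with (rsum (fun k => b2R (g k)) n).
        2:{ unfold c. induction n as [|n IH]; simpl; [reflexivity|].
            rewrite IH, plus_INR. now destruct (g n). }
        unfold Rdiv. simpl. now rewrite Rmult_1_r.
    + intros n. apply Rdiv_le_0_compat; [apply rsum_b2R_ge0|exact HM0].
    + intros n m Hnm. apply Rmult_le_compat_r.
      * left. now apply Rinv_0_lt_compat.
      * now apply rsum_b2R_mono.
    + intros B.
      destruct (rsum_b2R_diverges g Hinf ((B + 1) * INR M ^ 2)) as [N HN1].
      exists N. apply Rlt_le_trans with (B + 1); [lra|].
      apply Rle_div_r; [exact HM0|]. apply HN1. lia.
    + intros eps N Heps. destruct (Hdef N) as (n & Hn & L). exists n. split; [exact Hn|].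
      lra.
  - apply HN. apply (CH_frequency psi); auto.
  - apply HN. apply (CH_frequency psi); auto. apply HR; [exact HSel|].
    intros s t E. now rewrite E.
Qed.

(** * Incompatible forecasts *)

(** Once v (y - x) > 2, the first multiple of 1/v strictly beyond x lies before y. *)
Lemma rational_between x y : 0 <= x -> x < y ->
  exists u v, (0 < v)%nat /\ x < INR u / INR v < y.
Proof.
  intros Hx Hxy.
  destruct (INR_unbounded (2 / (y - x))) as [v Hv].
  assert (Hp : 0 < 2 / (y - x)) by (apply Rdiv_lt_0_compat; lra).
  apply Rlt_div_l in Hv; [|lra].
  assert (Hv0 : 0 < INR v) by nra.
  destruct (nfloor_ex (x * INR v)) as [u [Hu1 Hu2]]; [nra|].
  exists (S u), v. rewrite S_INR.
  split; [apply INR_lt; exact Hv0|].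
  split; [apply Rlt_div_r|apply Rlt_div_l]; nra.
Qed.

Lemma fraction_le_1 u v : (0 < v)%nat -> INR u / INR v < 1 -> (u <= v)%nat.
Proof.
  intros Hv H. apply lt_0_INR in Hv. apply Rlt_div_l in H; [|exact Hv].
  apply INR_le. lra.
Qed.

(** Two opposite bets are placed at the same times, up at r1 and down at r2 with r < r1 < r2 < q. On
    any outcome their gains add up to r2 - r1, while randomness eventually holds each mean gain to a
    quarter of that. *)
Lemma random_clash Rn psi1 psi2 w (g : nat -> bool) r q :
  recursive_fun (fun n => b2n (g n)) ->
  (forall N, exists n, (N <= n)%nat /\ g n = true) ->
  0 <= r -> r < q -> q <= 1 ->
  (forall s, g (length s) = true -> hi psi1 s <= r) ->
  (forall s, g (length s) = true -> q <= lo psi2 s) ->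
  random Rn psi1 w -> random Rn psi2 w -> False.
Proof.
  intros Hg Hinf Hr Hrq Hq H1 H2 HR1 HR2.
  (* The midpoint of [r] and [q] separates the two prices. *)
  destruct (rational_between r ((r + q) / 2)) as (u1 & v1 & Hv1 & L1 & L1'); [lra|lra|].
  destruct (rational_between ((r + q) / 2) q) as (u2 & v2 & Hv2 & L2 & L2'); [lra|lra|].
  set (r1 := INR u1 / INR v1) in *. set (r2 := INR u2 / INR v2) in *.
  destruct (random_frequency Rn psi1 w g true u1 v1 ((r2 - r1) / 4)) as [N1 HN1]; auto.
  { apply fraction_le_1; auto. fold r1. lra. }
  { intros s Hs. fold r1. specialize (H1 s Hs). lra. }
  { lra. }
  destruct (random_frequency Rn psi2 w g false u2 v2 ((r2 - r1) / 4)) as [N2 HN2]; auto.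
  { apply fraction_le_1; auto. fold r2. lra. }
  { intros s Hs. fold r2. specialize (H2 s Hs). lra. }
  { lra. }
  fold r1 in HN1. fold r2 in HN2.
  destruct (rsum_b2R_diverges g Hinf 1) as [N3 HN3].
  set (n := Nat.max N1 (Nat.max N2 N3)).
  specialize (HN1 n ltac:(lia)). specialize (HN2 n ltac:(lia)). specialize (HN3 n ltac:(lia)).
  pose proof (rsum_plus (fun k => b2R (g k) * gain true r1 (w k))
                        (fun k => b2R (g k) * gain false r2 (w k)) n) as E.
  rewrite (rsum_ext _ (fun k => (r2 - r1) * b2R (g k))) in E.
  2:{ intros k. simpl. ring. }
  rewrite rsum_scal in E. nra.
Qed.

(** Comparing a computable real with a bound is undecidable in general, but the gap between [x] and
    [y] leaves room to compare a rational approximation with a rational inside it. Temporality lets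
    the value be computed at one situation per length. *)
Lemma computable_threshold f x y :
  computable_on enc_sit f -> (forall s t, length s = length t -> f s = f t) ->
  0 <= x -> x < y ->
  exists g : nat -> bool, recursive_fun (fun n => b2n (g n)) /\
    forall s, if g (length s) then f s < y else x <= f s.
Proof.
  intros (q & (a & b & c & Ha & Hb & Hc & Eq) & Hq) Htemp Hx Hxy.
  (* A margin of d on both sides of u/v absorbs the approximation error, which is below d at
     precision [K]. *)
  set (d := (y - x) / 4).
  destruct (rational_between (x + d) (y - d)) as (u & v & Hv & L1 & L2);
    [unfold d; lra|unfold d; lra|].
  destruct (pow_lt_1_zero (/ 2)) with (y := d) as [K HK].
  { rewrite Rabs_pos_eq; lra. }
  { unfold d; lra. }
  specialize (HK K (le_n K)).
  rewrite Rabs_pos_eq in HK by (apply pow_le; lra).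
  (* The code of n zeros: a leading 0 turns the code e into 2 e + 1. *)
  set (zero := fun n => nat_rect (fun _ => nat) 0%nat (fun _ y => 2 * y + 1)%nat n).
  set (code := fun n => cpair (zero n) K).
  assert (Hcode : recursive_fun code).
  { apply rec_pair; auto with rec.
    apply (rec_nat_rect (fun _ => 0%nat) (fun n => n) (fun _ _ y => 2 * y + 1)%nat);
      auto 8 with rec. }
  assert (Ezero : forall n, zero n = enc_sit (repeat false n)).
  { induction n as [|n IH]; [reflexivity|].
    change (zero (S n)) with (2 * zero n + 1)%nat. rewrite IH. simpl. lia. }
  (* The approximation (a - b) / (c + 1) is compared with u/v after clearing denominators; [true]
     means that it is smaller. *)
  exists (fun n => negb (u * (c (code n) + 1) + v * b (code n) <=? v * a (code n))%nat).
  split.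
  - assert (RC : forall h, recursive_fun h -> recursive_fun (fun n => h (code n)))
      by (intros h Hh; exact (rec_comp h code Hh Hcode)).
    pose proof (RC a Ha). pose proof (RC b Hb). pose proof (RC c Hc).
    apply rec_negb, rec_leb; auto 7 with rec.
  - intros s. rewrite (Htemp s (repeat false (length s))) by now rewrite repeat_length.
    specialize (Hq (repeat false (length s)) K).
    rewrite <- Ezero in Hq. fold (code (length s)) in Hq.
    set (p := f _) in *. set (z := code (length s)) in *.
    rewrite Eq in Hq. apply Rabs_def2 in Hq.
    set (A := INR (a z)) in *. set (B := INR (b z)) in *. set (C := INR (c z) + 1) in *.
    assert (HC : 0 < C) by (unfold C; pose proof (pos_INR (c z)); lra).
    assert (HV : 0 < INR v) by now apply lt_0_INR.
    destruct (Nat.leb_spec (u * (c z + 1) + v * b z) (v * a z)) as [L|L]; simpl negb; cbv iota.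
    + apply le_INR in L. rewrite plus_INR, !mult_INR, plus_INR in L. simpl (INR 1) in L.
      fold A B C in L.
      assert (INR u / INR v <= (A - B) / C); [|lra].
      apply Rle_div_l; [exact HV|]. unfold Rdiv. rewrite Rmult_assoc, (Rmult_comm (/ C)), <- Rmult_assoc.
      apply Rle_div_r; lra.
    + apply lt_INR in L. rewrite plus_INR, !mult_INR, plus_INR in L. simpl (INR 1) in L.
      fold A B C in L.
      assert ((A - B) / C < INR u / INR v); [|lra].
      apply Rlt_div_l; [exact HC|]. unfold Rdiv. rewrite Rmult_assoc, (Rmult_comm (/ INR v)), <- Rmult_assoc.
      apply Rlt_div_r; lra.
Qed.

(** * Restarting tests along a path *)

Lemma recursive_Q_restart b q C :
  recursive_fun (fun z => b2n (b z)) -> recursive_Q q -> (0 < C)%nat ->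
  recursive_Q (fun z => if b z then q z / INR C else 1).
Proof.
  intros Hb (a & a' & c & Ha & Ha' & Hc & E) HC.
  exists (fun z => if b z then a z else 1%nat), (fun z => if b z then a' z else 0%nat),
    (fun z => if b z then pred ((c z + 1) * C) else 0%nat).
  split; [auto with rec|]. split; [auto with rec|]. split; [auto 8 with rec|].
  intros z. rewrite E. pose proof (pos_INR (c z)). apply lt_0_INR in HC as HC'.
  destruct (b z); simpl INR.
  - rewrite INR_pred_add1 by nia. rewrite mult_INR, plus_INR. simpl INR. field. lra.
  - field.
Qed.

(** As C is a natural number and at least 1, the approximations stay rational and their error does
    not grow. *)
Lemma computable_restart {D : Type} (enc : D -> nat) (r : D -> R) (b : nat -> bool)
    (P : D -> bool) C :
  recursive_fun (fun z => b2n (b z)) -> (forall d, b (enc d) = P d) -> (0 < C)%nat ->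
  computable_on enc r -> computable_on enc (fun d => if P d then r d / INR C else 1).
Proof.
  intros Hb EP HC (q & Hq & Hr).
  exists (fun z => if b (cfst z) then q z / INR C else 1). split.
  - apply (recursive_Q_restart (fun z => b (cfst z))); auto.
    apply (rec_comp (fun z => b2n (b z))); auto with rec.
  - intros d n. rewrite cfst_cpair, EP. specialize (Hr d n). destruct (P d).
    + unfold Rdiv. rewrite <- Rmult_minus_distr_r, Rabs_mult.
      apply le_INR in HC. simpl in HC.
      assert (0 < / INR C) by (apply Rinv_0_lt_compat; lra).
      assert (/ INR C <= 1) by (rewrite <- Rinv_1; apply Rinv_le_contravar; lra).
      rewrite (Rabs_pos_eq (/ INR C)) by lra.
      pose proof (Rabs_pos (r d - q (cpair (enc d) n))). nra.
    + rewrite Rminus_diag, Rabs_R0. apply pow_lt. lra.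
Qed.

Lemma lower_semicomputable_restart {D : Type} (enc : D -> nat) (r : D -> R)
    (b : nat -> bool) (P : D -> bool) C :
  recursive_fun (fun z => b2n (b z)) -> (forall d, b (enc d) = P d) -> (0 < C)%nat ->
  lower_semicomputable_on enc r ->
  lower_semicomputable_on enc (fun d => if P d then r d / INR C else 1).
Proof.
  intros Hb EP HC (q & Hq & Hmono & Hlim).
  assert (HC' : 0 < / INR C) by (apply Rinv_0_lt_compat, lt_0_INR, HC).
  exists (fun z => if b (cfst z) then q z / INR C else 1). split; [|split].
  - apply (recursive_Q_restart (fun z => b (cfst z))); auto.
    apply (rec_comp (fun z => b2n (b z))); auto with rec.
  - intros d n. rewrite !cfst_cpair, EP. destruct (P d); [|lra].
    apply Rmult_le_compat_r; [lra|apply Hmono].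
  - intros d eps Heps. destruct (P d) eqn:Ed.
    + destruct (Hlim d (eps * INR C)) as [N HN].
      { apply Rmult_lt_0_compat; [exact Heps|]. now apply lt_0_INR. }
      exists N. intros n Hn. specialize (HN n Hn). rewrite cfst_cpair, EP, Ed.
      unfold Rdist, Rdiv in *.
      rewrite <- Rmult_minus_distr_r, Rabs_mult, (Rabs_pos_eq (/ INR C)) by lra.
      apply Rlt_div_l; [now apply lt_0_INR|exact HN].
    + exists 0%nat. intros n _. rewrite cfst_cpair, EP, Ed. unfold Rdist.
      now rewrite Rminus_diag, Rabs_R0.
Qed.

(** C is left free: a natural number above F u keeps the approximations effective, while C = F u
    fits the multiplier form. *)
Definition restart (u : situation) (C : R) (F : situation -> R) (s : situation) : R :=
  if extends u s then F s / C else 1.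

(* At the last situation before [u] the restarted process moves from 1 to at most 1. *)
Lemma restart_test_supermartingale phi psi F u C :
  valid_fsys phi ->
  (forall s, (length u <= length s)%nat -> lo psi s <= lo phi s /\ hi phi s <= hi psi s) ->
  test_supermartingale psi F -> 0 < C -> F u <= C -> (u = [] -> F u = C) ->
  test_supermartingale phi (restart u C F).
Proof.
  intros Hphi Hsub (Hsup & Hpos & Hroot) HC Hu Hnil.
  assert (HC' : 0 < / C) by now apply Rinv_0_lt_compat.
  split; [|split].
  - intros s p Hp. unfold restart. destruct (extends u s) eqn:Es.
    + rewrite !(proj2 (extends_snoc u s _)) by now left.
      destruct (Hsub s (extends_length u s Es)) as [H1 H2].
      assert (H := Hsup s p ltac:(lra)). cbv beta in H.
      replace (_ + _) with (/ C * (p * (F (s ++ [true]) - F s) + (1 - p) * (F (s ++ [false]) - F s)))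
        by (unfold Rdiv; ring).
      nra.
    + assert (L : forall x, (if extends u (s ++ [x]) then F (s ++ [x]) / C else 1) <= 1).
      { intros x. destruct (extends u (s ++ [x])) eqn:Ex; [|lra].
        apply extends_snoc in Ex as [Ex|Ex]; [congruence|].
        rewrite <- Ex. apply Rle_div_l; lra. }
      pose proof (L true). pose proof (L false).
      destruct (Hphi s) as (? & ? & ?). nra.
  - intros s. unfold restart. destruct (extends u s); [|lra].
    apply Rmult_le_pos; [apply Hpos|lra].
  - unfold restart. destruct u as [|x u]; simpl; [|reflexivity].
    rewrite (Hnil eq_refl). field. lra.
Qed.

(** Suppressing the multipliers before [u] keeps the product form and divides the capital by exactly
    its value at [u], which therefore never has to be computed. *)
Definition restart_mult (u : situation) (D : situation -> bool -> R)
    (s : situation) (x : bool) : R :=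
  if extends u s then D s x else 1.

Lemma mult_proc_restart u D s :
  mult_proc D u <> 0 ->
  mult_proc (restart_mult u D) s = restart u (mult_proc D u) (mult_proc D) s.
Proof.
  intros Hu. induction s as [|x s IH] using rev_ind.
  - unfold restart. destruct u; simpl; [|reflexivity].
    unfold mult_proc. simpl. field.
  - rewrite mult_proc_snoc, IH. unfold restart, restart_mult.
    destruct (extends u s) eqn:Es.
    + rewrite (proj2 (extends_snoc u s x)) by now left.
      rewrite mult_proc_snoc. field. exact Hu.
    + destruct (extends u (s ++ [x])) eqn:Ex; [|ring].
      apply extends_snoc in Ex as [Ex|<-]; [congruence|]. field. exact Hu.
Qed.

Lemma limsup_infty_scale N C u v :
  0 < C -> (forall n, (N <= n)%nat -> v n = u n / C) ->
  limsup_infty u -> limsup_infty v.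
Proof.
  intros HC E Hu B K. destruct (Hu (B * C) (Nat.max N K)) as (n & Hn & L).
  exists n. split; [lia|]. rewrite E by lia. now apply Rlt_div_r.
Qed.

Lemma restart_prefix w N n C F : (N <= n)%nat ->
  restart (prefix w N) C F (prefix w n) = F (prefix w n) / C.
Proof. intros H. unfold restart. now rewrite extends_prefix. Qed.

(** * Transfer of randomness to wider forecasts *)

(** Each term before time N loses at most 1, so the total loss is at most N, which is negligible
    against a divergent count. *)
Lemma liminf_ge0_weighted_mean (sel : nat -> bool) f f' N :
  (forall k, (N <= k)%nat -> f k <= f' k) -> (forall k, f k <= f' k + 1) ->
  (forall M, exists K, forall n, (K <= n)%nat -> M <= rsum (fun k => b2R (sel k)) n) ->
  liminf_ge0 (fun n => rsum (fun k => b2R (sel k) * f k) n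
                       / rsum (fun k => b2R (sel k)) n) ->
  liminf_ge0 (fun n => rsum (fun k => b2R (sel k) * f' k) n
                       / rsum (fun k => b2R (sel k)) n).
Proof.
  intros Htail Hone Hdiv Hf eps Heps.
  destruct (Hf (eps / 2)) as [N1 HN1]; [lra|].
  (* Makes N at most eps / 2 times the count; the added 1 keeps the count positive. *)
  destruct (Hdiv (2 * INR N / eps + 1)) as [N2 HN2].
  exists (Nat.max N1 N2). intros n Hn.
  specialize (HN1 n ltac:(lia)). specialize (HN2 n ltac:(lia)).
  assert (H : rsum (fun k => b2R (sel k) * f k) n
              <= rsum (fun k => b2R (sel k) * f' k) n + INR (Nat.min n N)).
  { clear -Htail Hone. induction n as [|n IH]; [simpl; lra|]. simpl rsum.
    destruct (Nat.le_gt_cases N n) as [L|L].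
    - rewrite Nat.min_r in * by lia. specialize (Htail n L).
      destruct (sel n); simpl b2R; lra.
    - rewrite Nat.min_l in * by lia. rewrite S_INR. specialize (Hone n).
      destruct (sel n); simpl b2R; lra. }
  assert (Hmin : INR (Nat.min n N) <= INR N) by (apply le_INR; lia).
  set (c := rsum (fun k => b2R (sel k)) n) in *.
  assert (HN0 : 0 <= 2 * INR N / eps).
  { apply Rdiv_le_0_compat; [|lra]. pose proof (pos_INR N). lra. }
  assert (HN3 : 2 * INR N / eps <= c) by lra.
  apply Rle_div_l in HN3; [|lra].
  apply Rle_div_r in HN1; [|lra]. apply Rle_div_r; lra.
Qed.

Lemma CH_condition_widen phi psi w Sel N :
  valid_fsys phi -> valid_fsys psi ->
  (forall s, (N <= length s)%nat -> lo psi s <= lo phi s /\ hi phi s <= hi psi s) ->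
  CH_condition phi w Sel -> CH_condition psi w Sel.
Proof.
  intros Vphi Vpsi Hsub H Hdiv. destruct (H Hdiv) as [Hlo Hhi].
  assert (Hk : forall k, (N <= k)%nat -> lo psi (prefix w k) <= lo phi (prefix w k) /\
                 hi phi (prefix w k) <= hi psi (prefix w k)).
  { intros k L. apply Hsub. now rewrite prefix_length. }
  split.
  - refine (liminf_ge0_weighted_mean (fun k => Sel (prefix w k)) _ _ N _ _ Hdiv Hlo).
    + intros k L. specialize (Hk k L). lra.
    + intros k. destruct (Vphi (prefix w k)), (Vpsi (prefix w k)). lra.
  - apply limsup_le0_opp. apply limsup_le0_opp in Hhi.
    refine (liminf_ge0_weighted_mean (fun k => Sel (prefix w k)) _ _ N _ _ Hdiv Hhi).
    + intros k L. specialize (Hk k L). lra.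
    + intros k. destruct (Vphi (prefix w k)), (Vpsi (prefix w k)). lra.
Qed.

(** By contraposition for the martingale notions: a test against [psi] that succeeds on [w] is
    restarted where [phi] already lies inside [psi]. For the Church notions the averages are
    compared directly. *)
Lemma random_widen Rn phi psi w N :
  valid_fsys phi -> valid_fsys psi ->
  (forall s, (N <= length s)%nat -> lo psi s <= lo phi s /\ hi phi s <= hi psi s) ->
  random Rn phi w -> random Rn psi w.
Proof.
  intros Vphi Vpsi Hsub HR.
  (* At length [S N] the prefix is nonempty, so the restarted capital is 1 at the root even though C
     exceeds the value of F at the prefix. *)
  assert (Hrestart : forall F, test_supermartingale psi F ->
    exists C, (0 < C)%nat /\
      test_supermartingale phi (restart (prefix w (S N)) (INR C) F)).
  { intros F HF. destruct (INR_unbounded (F (prefix w (S N)))) as [C HC].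
    assert (HF0 := proj1 (proj2 HF) (prefix w (S N))).
    exists C. split; [apply INR_lt; simpl; lra|].
    apply (restart_test_supermartingale phi psi); auto; try lra.
    - intros s L. rewrite prefix_length in L. apply Hsub. lia.
    - discriminate. }
  destruct (rec_extends (prefix w (S N))) as (b & Hb & Eb).
  destruct Rn; simpl in *.
  - intros (T & HT & HTtest & Hlim). apply HR.
    destruct (Hrestart T HTtest) as (C & HC & Htest).
    exists (restart (prefix w (S N)) (INR C) T).
    split; [now apply (lower_semicomputable_restart enc_sit T b)|]. split; [exact Htest|].
    apply (limsup_infty_scale (S N) (INR C) (fun n => T (prefix w n)));
      [now apply lt_0_INR| |exact Hlim].
    intros n Hn. now apply restart_prefix.
  - intros (D & HD & HDtest & Hlim). apply HR.
    set (u := prefix w N).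
    (* A product that reaches 0 on [w] stays 0, which contradicts its success. *)
    assert (Hu : 0 < mult_proc D u).
    { destruct (proj1 (proj2 HDtest) u) as [|E]; [assumption|exfalso].
      assert (Z : forall n, (N <= n)%nat -> mult_proc D (prefix w n) = 0).
      { induction 1 as [|n _ IH]; [now symmetry|].
        rewrite prefix_S, mult_proc_snoc, IH. ring. }
      destruct (Hlim 0 N) as (n & Hn & L). rewrite Z in L by exact Hn. lra. }
    exists (restart_mult u D). split; [|split].
    + destruct (rec_extends u) as (b' & Hb' & Eb').
      (* With C = 1 the multipliers above [u] are unscaled; only the situation component of the pair
         is tested. *)
      destruct (lower_semicomputable_restart enc_sitx (fun p => D (fst p) (snd p))
                  (fun z => b' (cfst z)) (fun p => extends u (fst p)) 1) as (q & Hq & Hm & Hl).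
      * apply (rec_comp (fun z => b2n (b' z))); auto with rec.
      * intros [s x]. unfold enc_sitx. now rewrite cfst_cpair.
      * lia.
      * exact HD.
      * exists q. split; [exact Hq|]. split; [exact Hm|].
        intros p. specialize (Hl p). unfold restart_mult.
        simpl INR in Hl. now rewrite Rdiv_1_r in Hl.
    + assert (H : test_supermartingale phi (restart u (mult_proc D u) (mult_proc D))).
      { apply (restart_test_supermartingale phi psi); auto; try lra.
        intros s L. unfold u in L. rewrite prefix_length in L. now apply Hsub. }
      destruct H as (H1 & H2 & H3). split; [|split].
      * intros s p Hp. specialize (H1 s p Hp). now rewrite !mult_proc_restart by lra.
      * intros s. now rewrite mult_proc_restart by lra.
      * reflexivity.
    + apply (limsup_infty_scale N (mult_proc D u) (fun n => mult_proc D (prefix w n)));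
        [exact Hu| |exact Hlim].
      intros n Hn. rewrite mult_proc_restart by lra. now apply restart_prefix.
  - intros (T & HT & HTtest & Hlim). apply HR.
    destruct (Hrestart T HTtest) as (C & HC & Htest).
    exists (restart (prefix w (S N)) (INR C) T).
    split; [now apply (computable_restart enc_sit T b)|]. split; [exact Htest|].
    apply (limsup_infty_scale (S N) (INR C) (fun n => T (prefix w n)));
      [now apply lt_0_INR| |exact Hlim].
    intros n Hn. now apply restart_prefix.
  - intros (T & tau & HT & HTtest & Htau & Hpos & Hmono & Hunb & Hlim). apply HR.
    destruct (Hrestart T HTtest) as (C & HC & Htest).
    assert (HC' : 0 < INR C) by now apply lt_0_INR.
    assert (HCinv : 0 < / INR C) by now apply Rinv_0_lt_compat.
    (* Capital and growth function are divided by the same C, which preserves their comparison. *)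
    exists (restart (prefix w (S N)) (INR C) T), (fun n => tau n / INR C).
    split; [now apply (computable_restart enc_sit T b)|]. split; [exact Htest|].
    split; [|split; [|split; [|split]]].
    + apply (computable_restart (fun n => n) tau (fun _ => true) (fun _ => true)); auto.
      apply rec_const.
    + intros n. apply Rmult_le_pos; [apply Hpos|lra].
    + intros n m L. apply Rmult_le_compat_r; [lra|auto].
    + intros B. destruct (Hunb (B * INR C)) as [n Hn]. exists n. now apply Rlt_div_r.
    + intros eps K Heps.
      destruct (Hlim (eps * INR C) (Nat.max K (S N))) as (n & Hn & L);
        [now apply Rmult_lt_0_compat|].
      exists n. split; [lia|]. rewrite restart_prefix by lia.
      unfold Rdiv. rewrite <- Rmult_minus_distr_r.
      apply Rlt_div_r; [exact HC'|]. lra.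
  - intros Sel HSel. apply (CH_condition_widen phi psi w Sel N); auto.
  - intros Sel HSel Htemp. apply (CH_condition_widen phi psi w Sel N); auto.
Qed.

(** * Lower and upper limits *)

Lemma LimInf_seq_frequently u x y :
  Rbar_le (LimInf_seq u) (Finite x) -> x < y ->
  forall N, exists n, (N <= n)%nat /\ u n < y.
Proof.
  intros Hx Hxy N. pose proof (proj2_sig (ex_LimInf_seq u)) as H; fold (LimInf_seq u) in H.
  destruct (LimInf_seq u) as [l| |]; simpl in Hx; [|contradiction|apply H].
  destruct (H (mkposreal (y - x) ltac:(lra))) as [H1 _]. simpl in H1.
  destruct (H1 N) as (n & Hn & L). exists n. split; [exact Hn|lra].
Qed.

Lemma LimInf_seq_eventually u x :
  ~ Rbar_le (LimInf_seq u) (Finite x) ->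
  exists y N, x < y /\ forall n, (N <= n)%nat -> y < u n.
Proof.
  intros Hx. pose proof (proj2_sig (ex_LimInf_seq u)) as H; fold (LimInf_seq u) in H.
  destruct (LimInf_seq u) as [l| |]; simpl in Hx; [| |tauto].
  - apply Rnot_le_lt in Hx.
    destruct (H (mkposreal ((l - x) / 2) ltac:(lra))) as [_ [N HN]]. simpl in HN.
    (* The midpoint of [x] and the limit inferior. *)
    exists (l - (l - x) / 2), N. split; [lra|exact HN].
  - destruct (H (x + 1)) as [N HN]. exists (x + 1), N. split; [lra|exact HN].
Qed.

Lemma LimSup_seq_frequently u x y :
  Rbar_le (Finite x) (LimSup_seq u) -> y < x ->
  forall N, exists n, (N <= n)%nat /\ y < u n.
Proof.
  intros Hx Hxy N. pose proof (proj2_sig (ex_LimSup_seq u)) as H; fold (LimSup_seq u) in H.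
  destruct (LimSup_seq u) as [l| |]; simpl in Hx; [|apply H|contradiction].
  destruct (H (mkposreal (x - y) ltac:(lra))) as [H1 _]. simpl in H1.
  destruct (H1 N) as (n & Hn & L). exists n. split; [exact Hn|lra].
Qed.

Lemma LimSup_seq_eventually u x :
  ~ Rbar_le (Finite x) (LimSup_seq u) ->
  exists y N, y < x /\ forall n, (N <= n)%nat -> u n < y.
Proof.
  intros Hx. pose proof (proj2_sig (ex_LimSup_seq u)) as H; fold (LimSup_seq u) in H.
  destruct (LimSup_seq u) as [l| |]; simpl in Hx; [|tauto|].
  - apply Rnot_le_lt in Hx.
    destruct (H (mkposreal ((x - l) / 2) ltac:(lra))) as [_ [N HN]]. simpl in HN.
    exists (l + (x - l) / 2), N. split; [lra|exact HN].
  - destruct (H (x - 1)) as [N HN]. exists (x - 1), N. split; [lra|exact HN].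
Qed.

(** * The two inclusions *)

Theorem theorem2 (Rn : rnotion) (phi : fsys) (w : path) :
  valid_fsys phi -> computable_fsys phi -> precise phi -> temporal phi ->
  random Rn phi w ->
  forall x : R, I_R Rn w x <-> I_phi phi w x.
Proof.
  intros V [Comp _] Prec Temp HR x.
  assert (Tl : forall s t, length s = length t -> lo phi s = lo phi t)
    by (intros s t E; apply (Temp s t E)).
  split.
  (* If x lay below the limit inferior, phi would stay above some y > x from some time on, and [w]
     would be random for the interval from max(0, y) to 1, which misses x. The upper end is
     symmetric. *)
  - intros HI. split; apply NNPP; intros C.
    + apply LimInf_seq_eventually in C as (y & N & Hy & HN).
      (* Temporality carries the bound from the prefixes of [w] to all situations of the same
         length; the maximum with 0 keeps the interval inside [0, 1]. *)
      assert (Hlo : forall s, (N <= length s)%nat -> Rmax 0 y <= lo phi s).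
      { intros s L. specialize (HN (length s) L).
        rewrite (Tl _ s) in HN by apply prefix_length.
        destruct (V s). apply Rmax_lub; lra. }
      assert (Hv : valid_interval (Rmax 0 y) 1).
      { specialize (Hlo (prefix w N)). rewrite prefix_length in Hlo.
        specialize (Hlo (le_n N)). destruct (V (prefix w N)) as (? & ? & ?).
        pose proof (Rmax_l 0 y). repeat split; lra. }
      assert (H := HI _ _ Hv).
      pose proof (Rmax_r 0 y).
      enough (random Rn (const_fsys (Rmax 0 y) 1) w) by (specialize (H ltac:(assumption)); lra).
      apply (random_widen Rn phi _ w N); auto.
      * intros s. exact Hv.
      * intros s L. simpl. destruct (V s) as (? & ? & ?). split; [auto|lra].
    + apply LimSup_seq_eventually in C as (y & N & Hy & HN).
      assert (Hhi : forall s, (N <= length s)%nat -> hi phi s <= Rmin 1 y).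
      { intros s L. specialize (HN (length s) L).
        rewrite (proj2 (Temp _ s (prefix_length w (length s)))) in HN.
        destruct (V s) as (? & ? & ?). apply Rmin_glb; lra. }
      assert (Hv : valid_interval 0 (Rmin 1 y)).
      { specialize (Hhi (prefix w N)). rewrite prefix_length in Hhi.
        specialize (Hhi (le_n N)). destruct (V (prefix w N)) as (? & ? & ?).
        pose proof (Rmin_l 1 y). repeat split; lra. }
      assert (H := HI _ _ Hv).
      pose proof (Rmin_r 1 y).
      enough (random Rn (const_fsys 0 (Rmin 1 y)) w) by (specialize (H ltac:(assumption)); lra).
      apply (random_widen Rn phi _ w N); auto.
      * intros s. exact Hv.
      * intros s L. simpl. destruct (V s) as (? & ? & ?). split; [lra|auto].
  - intros [Hinf Hsup] a b (Ha & Hab & Hb) Hrand. split; apply Rnot_lt_le; intros L.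
    + assert (Freq := fun y => LimInf_seq_frequently _ x y Hinf).
      assert (0 <= x).
      { apply Rnot_lt_le. intros Hx. destruct (Freq 0 Hx 0%nat) as (n & _ & H).
        destruct (V (prefix w n)). lra. }
      (* phi falls below x + d infinitely often, and every selected time has phi below x + 2 d < a:
         the forecasts phi and [a, b] clash there. *)
      set (d := (a - x) / 4).
      destruct (computable_threshold (lo phi) (x + d) (x + 2 * d)) as (g & Hg & Eg);
        auto; [unfold d; lra|unfold d; lra|].
      apply (random_clash Rn phi (const_fsys a b) w g (x + 2 * d) a);
        auto; try (unfold d; lra).
      * intros N. destruct (Freq (x + d) ltac:(unfold d; lra) N) as (n & Hn & H1).
        exists n. split; [exact Hn|]. specialize (Eg (prefix w n)).
        rewrite prefix_length in Eg. destruct (g n); [reflexivity|lra].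
      (* The threshold was decided for the lower end point; precision makes it a bound on the upper
         one. *)
      * intros s Es. specialize (Eg s). rewrite Es in Eg. rewrite <- Prec. lra.
      * intros s _. simpl. lra.
    + assert (Freq := fun y => LimSup_seq_frequently _ x y Hsup).
      assert (x <= 1).
      { apply Rnot_lt_le. intros Hx. destruct (Freq 1 Hx 0%nat) as (n & _ & H).
        destruct (V (prefix w n)) as (? & ? & ?). lra. }
      set (d := (x - b) / 4).
      (* [g] marks the times of small forecasts, so its negation is used: it holds whenever phi
         exceeds b + 3 d, and guarantees phi >= b + 2 d > b. *)
      destruct (computable_threshold (lo phi) (b + 2 * d) (b + 3 * d)) as (g & Hg & Eg);
        auto; [unfold d; lra|unfold d; lra|].
      apply (random_clash Rn (const_fsys a b) phi w (fun n => negb (g n)) b (b + 2 * d));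
        auto with rec; try (unfold d; lra).
      * intros N. destruct (Freq (b + 3 * d) ltac:(unfold d; lra) N) as (n & Hn & H1).
        exists n. split; [exact Hn|]. specialize (Eg (prefix w n)).
        rewrite prefix_length in Eg. rewrite <- Prec in H1.
        destruct (g n); [lra|reflexivity].
      * intros s _. simpl. lra.
      * intros s Es. specialize (Eg s). destruct (g (length s)); [discriminate|exact Eg].
Qed.
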